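(* For any $T>0$, any $N>0$ and any $\mathcal{G}(\cdot)\in C(\mathbb{R}^+,\mathbb{R}^+)$, it holds that $$\sup\Big\|u(T,\cdot)-\sum_{n\in\mathbb{Z}^d,\,|n|\le\mathcal{G}(N)}u(T,n/N)\,f_{N,n}(\cdot)\Big\|\ge\frac12(T+1)^{-\frac d4},$$ where the supremum is taken over all solutions $u$ to the heat equation $\partial_tu=\triangle u$ on $\mathbb{R}^+\times\mathbb{R}^d$ with $u(0,\cdot)\in L^2(\mathbb{R}^d)$ and $\|u(0,\cdot)\|\le1$.
   Context: $d\ge1$ is an integer, $\mathbb{R}^+=(0,\infty)$, and $\|\cdot\|$ is the norm of $L^2(\mathbb{R}^d)$. For $N>0$ and $n\in\mathbb{Z}^d$, $f_{N,n}(x)=\prod_{j=1}^d\frac{\sin\pi(Nx_j-n_j)}{\pi(Nx_j-n_j)}$ (with value $1$ for a factor whose denominator vanishes). Solutions to the heat equation are $u(t,\cdot)=e^{t\triangle}u(0,\cdot)$, with $\{e^{t\triangle}\}_{t\ge0}$ the heat semigroup on $L^2(\mathbb{R}^d)$; $u(T,\cdot)$ is smooth for $T>0$. $|n|$ is the Euclidean norm of $n$. *)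

(* Defs.v *)
From HB Require Import structures.
From mathcomp Require Import all_boot all_order all_algebra.
From mathcomp Require Import all_classical all_reals all_analysis.
From mathcomp Require Import zify.

Set Implicit Arguments.
Unset Strict Implicit.
Unset Printing Implicit Defensive.

Import Order.TTheory GRing.Theory Num.Theory.
Import numFieldNormedType.Exports.

Local Open Scope classical_set_scope.
Local Open Scope ring_scope.

(* The library has no Lebesgue measure on R^d.  R^d is d.-tuple R with the
   product Borel sigma-algebra; its Lebesgue measure is the d-fold product of
   the one-dimensional one, transported along R * R^n ~ R^(n+1).  The type
   measurableTypeR R is R itself with the Borel structure on which
   lebesgue_measure is declared. *)
Notation Rn R n := (n.-tuple (measurableTypeR R)).

Section lebesgue_Rn.
Context {R : realType}.

Definition consRn n (p : measurableTypeR R * Rn R n) : Rn R n.+1 :=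
  [the n.+1.-tuple _ of p.1 :: p.2].

Definition tailRn n (x : Rn R n.+1) : Rn R n := [tuple of behead x].

Lemma measurable_consRn n : measurable_fun [set: _] (@consRn n).
Proof. exact: measurable_cons. Qed.

Section step.
Context n (mu : {sigma_finite_measure set (Rn R n) -> \bar R}).

Definition lebesgue_step : set (Rn R n.+1) -> \bar R :=
  pushforward (lebesgue_measure \x mu)%E (@consRn n).

Let step0 : lebesgue_step set0 = 0%E.
Proof. by rewrite /lebesgue_step /pushforward preimage_set0 measure0. Qed.

Let step_ge0 A : (0 <= lebesgue_step A)%E.
Proof. by rewrite /lebesgue_step /pushforward; exact: measure_ge0. Qed.

Let step_additive : semi_sigma_additive lebesgue_step.
Proof.
move=> F mF tF mUF; rewrite /lebesgue_step /pushforward preimage_bigcup.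
apply: measure_semi_sigma_additive.
- by move=> k; rewrite -[X in measurable X]setTI; exact: measurable_consRn.
- apply/trivIsetP => /= i j _ _ ij; rewrite -preimage_setI.
  by move/trivIsetP : tF => /(_ _ _ _ _ ij) ->//; rewrite preimage_set0.
- by rewrite -preimage_bigcup -[X in measurable X]setTI; exact: measurable_consRn.
Qed.

HB.instance Definition _ :=
  isMeasure.Build _ _ _ lebesgue_step step0 step_ge0 step_additive.

Lemma lebesgue_step_box (A : set (measurableTypeR R)) (B : set (Rn R n)) :
  measurable A -> measurable B ->
  lebesgue_step [set x : Rn R n.+1 | A (thead x) /\ B (tailRn x)]
  = (lebesgue_measure A * mu B)%E.
Proof.
move=> mA mB; rewrite -product_measure1E//; congr (product_measure1 _ _ _).
apply/funext => -[a t]; apply: propext => /=; rewrite /setX /consRn /= theadE.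
by rewrite (_ : tailRn _ = t)//; exact: val_inj.
Qed.

Let step_sigma_finite : sigma_finite setT lebesgue_step.
Proof.
have /sigma_finiteP[F [TF ndF Foo]] := sigma_finiteT (@lebesgue_measure R).
have /sigma_finiteP[G [TG ndG Goo]] := sigma_finiteT mu.
exists (fun k => [set x : Rn R n.+1 | F k (thead x) /\ G k (tailRn x)]).
  rewrite predeqE => x; split=> // _.
  have : setT (thead x) by []. rewrite TF => -[i _ Fi].
  have : setT (tailRn x) by []. rewrite TG => -[j _ Gj].
  exists (maxn i j) => //; split.
    by move: Fi; exact/subsetPset/ndF/leq_maxl.
  by move: Gj; exact/subsetPset/ndG/leq_maxr.
move=> k; have [? ?] := Foo k; have [? ?] := Goo k; split; last first.
  by rewrite lebesgue_step_box// lte_mul_pinfty// ge0_fin_numE.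
rewrite (_ : mkset _ = (@thead n _) @^-1` F k `&` @tailRn n @^-1` G k)//.
apply: measurableI; rewrite -[X in measurable X]setTI.
- by apply: (measurable_tnth ord0).
- by apply: measurable_behead.
Qed.

HB.instance Definition _ :=
  Measure_isSigmaFinite.Build _ _ _ lebesgue_step step_sigma_finite.

End step.

Fixpoint lebesgue_Rn n : {sigma_finite_measure set (Rn R n) -> \bar R} :=
  match n with
  | 0 => \d_([tuple] : Rn R 0)
  | m.+1 => lebesgue_step (lebesgue_Rn m)
  end.

(* By uniqueness of product measures, this characterizes lebesgue_Rn. *)
Lemma lebesgue_Rn_box n (A : 'I_n -> set (measurableTypeR R)) :
  (forall i, measurable (A i)) ->
  lebesgue_Rn n [set x : Rn R n | forall i, A i (tnth x i)]
  = (\prod_(i < n) lebesgue_measure (A i))%E.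
Proof.
elim: n A => [|n IHn] A mA.
  by rewrite big_ord0 /= diracE mem_set// => -[].
have mB : measurable [set x : Rn R n | forall i, A (lift ord0 i) (tnth x i)].
  rewrite (_ : mkset _ = \bigcap_(i in [set: 'I_n])
      ((fun x : Rn R n => tnth x i) @^-1` A (lift ord0 i))); last first.
    by apply/seteqP; split => x /= h i; [move=> _; exact: h|exact: (h i I)].
  apply: fin_bigcap_measurable => // i _; rewrite -[X in measurable X]setTI.
  by apply: measurable_tnth.
rewrite big_ord_recl -IHn// -lebesgue_step_box//; congr (lebesgue_step _ _).
have tailE (x : Rn R n.+1) i : tnth (tailRn x) i = tnth x (lift ord0 i).
  rewrite tnth_behead; congr tnth; apply: val_inj.
  by rewrite /= inordK ?ltnS// lift0.
apply/seteqP; split => x /=.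
  by move=> h; split=> [|i]; [exact: h|rewrite tailE; exact: h].
move=> [h0 h] i; case: (unliftP ord0 i) => [j ->|->//].
by have := h j; rewrite tailE.
Qed.

End lebesgue_Rn.

Section heat_sampling.
Context {R : realType}.
Implicit Types (d : nat) (t T N r : R).

Definition enorm d (x : Rn R d) : R := Num.sqrt (\sum_(i < d) (tnth x i : R) ^+ 2).

Definition subRn d (x y : Rn R d) : Rn R d :=
  [tuple (tnth x i : R) - (tnth y i : R) | i < d].

(* The lattice point n / N; lattice_pt 1 n is n itself, seen in R^d. *)
Definition lattice_pt d N (n : d.-tuple int) : Rn R d :=
  [tuple (tnth n i)%:~R / N | i < d].

Definition L2norm d (f : Rn R d -> R) : \bar R :=
  'N[@lebesgue_Rn R d]_(2%:E)[EFin \o f].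

(* Gauss-Weierstrass kernel: the fundamental solution of the heat equation
   d_t u = Laplacian u (without a factor 1/2). *)
Definition heat_kernel d t (x : Rn R d) : R :=
  (4 * pi * t) `^ (- (d%:R / 2)) * expR (- (enorm x ^+ 2 / (4 * t))).

(* The heat semigroup e^(t Laplacian) acting on (representatives of) L^2(R^d).
   For t > 0 the integrand is integrable at every x, the integral depends only
   on the class of f, and it is the smooth representative of e^(t Laplacian) f,
   so that point values make sense. *)
Definition heat_semigroup d t (f : Rn R d -> R) : Rn R d -> R :=
  if t == 0 then f
  else fun x => (\int[@lebesgue_Rn R d]_y (heat_kernel t (subRn x y) * f y))%R.

Definition heat_solution d (u : R -> Rn R d -> R) : Prop :=
  u 0 \in Lfun (@lebesgue_Rn R d) 2%:E /\
  forall t, 0 <= t -> u t = heat_semigroup t (u 0).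

Definition sinc_pi r : R := if r == 0 then 1 else sin (pi * r) / (pi * r).

Definition cardinal_fun d N (n : d.-tuple int) (x : Rn R d) : R :=
  \prod_(j < d) sinc_pi (N * (tnth x j : R) - (tnth n j)%:~R).

(* The index set is finite (finite_sampling_set), so this is the plain sum. *)
Definition sampling_sum d N r (v : Rn R d -> R) (x : Rn R d) : R :=
  \sum_(n \in [set n : d.-tuple int | enorm (lattice_pt 1 n) <= r])
    v (lattice_pt N n) * cardinal_fun N n x.

Lemma finite_sampling_set d r :
  finite_set [set n : d.-tuple int | enorm (lattice_pt 1 n) <= r].
Proof.
pose k := `|Num.ceil r|%N.
pose F := [set n : d.-tuple int | forall i, - k%:Z <= tnth n i <= k%:Z].
suff finF : finite_set F.
  apply: sub_finite_set finF => n /= nr i.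
  have : `|(tnth n i)%:~R : R| <= r.
    apply: le_trans nr; rewrite -sqrtr_sqr ler_sqrt ?sumr_ge0//; last first.
      by move=> j _; exact: sqr_ge0.
    rewrite (bigD1 i)//= tnth_mktuple divr1 lerDl sumr_ge0// => j _.
    exact: sqr_ge0.
  rewrite -intr_norm => nir.
  have r0 : 0 <= r by apply: le_trans nir; rewrite ler0z.
  have : `|tnth n i| <= k%:Z.
    rewrite /k gez0_abs ?ceil_ge0 ?(lt_le_trans _ r0)// -(ler_int R).
    by apply: le_trans nir _; exact: Num.Theory.ceil_ge.
  by rewrite -ler_norml.
pose f (g : {ffun 'I_d -> 'I_(k.*2.+1)}) : d.-tuple int :=
  [tuple (g i : nat)%:Z - k%:Z | i < d].
apply: (@sub_finite_set _ _ (f @` [set: _])); last first.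
  by apply: finite_image; exact: finite_finset.
move=> n /= nF; pose h i : int := tnth n i + k%:Z.
have hk i : (`|h i| < k.*2.+1)%N.
  by have := nF i; rewrite /h => /andP[? ?]; lia.
exists [ffun i => Ordinal (hk i)] => //; apply: eq_from_tnth => i.
rewrite tnth_mktuple ffunE /=; have := nF i; rewrite /h => /andP[? ?].
by lia.
Qed.

Definition sampling_error d T N r (u : R -> Rn R d -> R) : \bar R :=
  L2norm (fun x => u T x - sampling_sum N r (u T) x).

End heat_sampling.

(* Main.v *)
Require Import Defs.
From mathcomp Require Import all_boot all_order all_algebra.
From mathcomp Require Import finmap.
From mathcomp Require Import all_classical all_reals all_analysis.
From mathcomp Require Import measurable_realfun ring lra.
Import Order.TTheory GRing.Theory Num.Theory.
Import numFieldNormedType.Exports.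
Local Open Scope classical_set_scope.
Local Open Scope ring_scope.

(** Sampling inside a fixed ball cannot see a heat distribution that lives far
    away from that ball.

    As initial datum take the Gaussian [c exp(-|x - a|^2 / 4)] of unit norm,
    i.e. a multiple of the heat kernel at time 1, centred at [a = (s, ..., s)].
    By the semigroup property, at time [T] it is again a Gaussian centred at
    [a], a multiple [phi] of the heat kernel at time [T + 1]
    ([heat_semigroup_gaussian]), and [||phi||^2 = (T + 1)^(-d/2)]
    ([integral_sqr_evolved_gaussian]).  Neither this norm nor the integral [M]
    of [phi] depends on [s].  As [s] tends to infinity, the finitely many
    samples of [phi] tend to zero ([sampled_gaussian_vanishing]); since the
    cardinal functions are bounded by 1, the whole sampling sum [S] is
    uniformly small, say [|S| <= e] ([norm_sampling_sum_le]).

    A uniform bound on [S] is enough: because [phi >= 0],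
    [(phi - S)^2 >= phi^2 - 2 e phi] pointwise, hence
    [||phi - S||^2 >= ||phi||^2 - 2 e M] ([le_integral_sqr_perturb]), and
    the last term is as small as desired.

    All Gaussian integrals over R^d reduce to one-dimensional ones, because the
    integral of a product of functions of one coordinate each is the product
    of their integrals ([integral_Rn_prod]). *)

(** * One-dimensional Gaussians *)

Section gaussian.
Context {R : realType}.
Implicit Types v m s x y t : R.

(** The scale is that of the heat kernel: [v = 4 t] at time [t], which is twice
    the variance. *)
Definition gaussian v m x : R := expR (- ((x - m) ^+ 2 / v)).

Lemma gaussian_ge0 v m x : 0 <= gaussian v m x.
Proof. exact: expR_ge0. Qed.

Lemma gaussian_le1 v m x : 0 <= v -> gaussian v m x <= 1.
Proof.
move=> v0; rewrite /gaussian -expR0 ler_expR oppr_le0.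
by rewrite divr_ge0// sqr_ge0.
Qed.

Lemma gaussianX2 v m x : gaussian v m x ^+ 2 = gaussian (v / 2) m x.
Proof.
rewrite /gaussian -expRM_natl mulrN; congr (expR (- _)).
by rewrite invf_div mulrA mulrAC mulrC mulrA.
Qed.

Lemma measurable_gaussian v m :
  measurable_fun [set: measurableTypeR R] (gaussian v m).
Proof.
apply: measurableT_comp => //=; apply: measurableT_comp => //=.
apply: measurable_funM => //=; apply: measurable_funX => //=.
exact: measurable_funB.
Qed.

(** Up to its normalization this is the normal density of variance [v / 2]. *)
Lemma integral_gaussian v m : 0 < v ->
  (\int[lebesgue_measure]_x (gaussian v m x)%:E = (Num.sqrt (pi * v))%:E)%E.
Proof.
move=> v0; pose sd := Num.sqrt (v / 2).
have sd0 : sd != 0 by rewrite gt_eqF// sqrtr_gt0 divr_gt0.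
have sd2 : sd ^+ 2 *+ 2 = v.
  by rewrite sqr_sqrtr ?divr_ge0// ?ltW// -mulr_natr divfK.
have peak : normal_peak sd = (Num.sqrt (pi * v))^-1.
  by rewrite /normal_peak -mulrnAl sd2 mulrC.
have peak0 : Num.sqrt (pi * v) != 0.
  by rewrite gt_eqF// sqrtr_gt0 mulr_gt0// pi_gt0.
under eq_integral => x _.
  rewrite (_ : gaussian v m x =
    Num.sqrt (pi * v) * normal_pdf m sd x); last first.
    by rewrite normal_pdfE// peak mulrA divff// mul1r /normal_fun sd2 mulNr.
  rewrite EFinM; over.
rewrite integralZl//=; last exact: integrable_normal_pdf.
by rewrite integral_normal_pdf mule1.
Qed.

Lemma gaussian_vanishing v (b e : R) : 0 < v -> 0 < e ->
  exists s, forall x, x <= b -> gaussian v s x <= e.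
Proof.
(* With [y = (x - s)^2 / v], the bound [exp (- y) <= 1 / y] makes it enough that
   the centre be at distance [sqrt (v / e)] from the half-line. *)
move=> v0 e0; exists (b + Num.sqrt (v / e)) => x xb.
have ve0 : 0 < v / e by rewrite divr_gt0.
suff h : e^-1 <= expR ((x - (b + Num.sqrt (v / e))) ^+ 2 / v).
  by rewrite /gaussian expRN -[leRHS]invrK lef_pV2 ?posrE ?invr_gt0 ?expR_gt0.
apply: (@le_trans _ _ ((x - (b + Num.sqrt (v / e))) ^+ 2 / v)); last first.
  by apply: le_trans (expR_ge1Dx _); rewrite lerDr.
rewrite ler_pdivlMr// mulrC -sqrrN -[leLHS]sqr_sqrtr ?(ltW ve0)//.
rewrite ler_pXn2r ?nnegrE ?sqrtr_ge0//; first lra.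
by have := sqrtr_ge0 (v / e); lra.
Qed.

End gaussian.

(** * Integration over R^d *)

Section integral_Rn.
Context {R : realType}.

Lemma measurable_prod_tnth n (g : 'I_n -> R -> R) :
  (forall i, measurable_fun [set: measurableTypeR R] (g i)) ->
  measurable_fun [set: Rn R n] (fun x : Rn R n => \prod_(i < n) g i (tnth x i)).
Proof.
move=> mg; apply: measurable_fun_approximation.measurable_prod => i _.
apply: (measurableT_comp (mg i)); exact: measurable_tnth.
Qed.

(** Tonelli, one coordinate at a time: the measure on R^(n+1) is the image under
    [consRn] of the product of the measures on R and R^n. *)
Lemma integral_Rn_prod n (g : 'I_n -> R -> R) :
  (forall i, measurable_fun [set: measurableTypeR R] (g i)) ->
  (forall i x, 0 <= g i x) ->
  (\int[@lebesgue_Rn R n]_x (\prod_(i < n) g i (tnth x i))%:E =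
   \prod_(i < n) \int[lebesgue_measure]_x (g i x)%:E)%E.
Proof.
elim: n g => [|n IHn] g mg g0.
  rewrite big_ord0; under eq_integral do rewrite big_ord0.
  by rewrite /= integral_dirac// diracT mul1e.
rewrite [LHS](@ge0_integral_pushforward _ _ _ _ _ _ (@measurable_consRn R n)
   (lebesgue_measure \x lebesgue_Rn n)%E setT)//; last 2 first.
- by apply/measurable_EFinP; exact: measurable_prod_tnth.
- by move=> x _; rewrite lee_fin prodr_ge0.
rewrite preimage_setT.
have m1 (p : measurableTypeR R * Rn R n) :
   (\prod_(i < n.+1) g i (tnth (consRn p) i))%:E =
   ((g ord0 p.1)%:E * (\prod_(i < n) g (lift ord0 i) (tnth p.2 i))%:E)%E.
  rewrite big_ord_recl EFinM; congr (_ * _)%E; congr _%:E.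
  apply: eq_bigr => i _.
  by congr g; rewrite /consRn tnthS.
rewrite (eq_integral _ _ (fun p _ => m1 p)).
rewrite fubini_tonelli1//=; last 2 first.
- apply: emeasurable_funM; apply/measurable_EFinP.
    exact: (measurableT_comp (mg ord0) measurable_fst).
  exact: (measurableT_comp
    (measurable_prod_tnth _ _ (fun i => mg (lift ord0 i))) measurable_snd).
- by move=> x; rewrite mule_ge0// lee_fin// prodr_ge0.
rewrite big_ord_recl -(IHn (fun i => g (lift ord0 i)))//.
rewrite /fubini_F -ge0_integralZr//=; last 3 first.
- by apply/measurable_EFinP; exact: mg.
- by move=> x _; rewrite lee_fin.
- by apply: integral_ge0 => x _; rewrite lee_fin prodr_ge0.
apply: eq_integral => x _; rewrite ge0_integralZl_EFin//.
- by move=> y _; rewrite lee_fin prodr_ge0.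
- apply/measurable_EFinP.
  exact: (measurable_prod_tnth _ (fun i => g (lift ord0 i))).
Qed.

End integral_Rn.

(** * Gaussians on R^d and the heat semigroup *)

Section gaussian_Rn.
Context {R : realType}.
Implicit Types (d : nat) (v s t c : R).

(** Written as a product rather than as the exponential of a Euclidean norm, so
    that [integral_Rn_prod] applies; the centre is [(s, ..., s)]. *)
Definition gaussian_Rn d v s (x : Rn R d) : R :=
  \prod_(i < d) gaussian v s (tnth x i).

Lemma gaussian_Rn_ge0 d v s x : 0 <= gaussian_Rn d v s x.
Proof. by rewrite prodr_ge0// => i _; exact: gaussian_ge0. Qed.

Lemma gaussian_RnX2 d v s x :
  gaussian_Rn d v s x ^+ 2 = gaussian_Rn d (v / 2) s x.
Proof.
by rewrite /gaussian_Rn -prodrXl; apply: eq_bigr => i _; rewrite gaussianX2.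
Qed.

Lemma measurable_gaussian_Rn d v s :
  measurable_fun [set: Rn R d] (gaussian_Rn d v s).
Proof.
apply: (measurable_prod_tnth d (fun=> gaussian v s)) => i.
exact: measurable_gaussian.
Qed.

Lemma integral_gaussian_Rn d v s : 0 < v ->
  (\int[@lebesgue_Rn R d]_x (gaussian_Rn d v s x)%:E =
   (Num.sqrt (pi * v) ^+ d)%:E)%E.
Proof.
move=> v0; rewrite (integral_Rn_prod d (fun=> gaussian v s)).
- rewrite (eq_bigr (fun=> (Num.sqrt (pi * v))%:E)); last first.
    by move=> i _; exact: integral_gaussian.
  by rewrite prodEFin prodr_const card_ord.
- by move=> i; exact: measurable_gaussian.
- by move=> i x; exact: gaussian_ge0.
Qed.

Lemma heat_kernel_prod d t (x : Rn R d) : 0 < t ->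
  heat_kernel t x =
  \prod_(i < d) ((Num.sqrt (4 * pi * t))^-1 * gaussian (4 * t) 0 (tnth x i)).
Proof.
move=> t0; rewrite /heat_kernel big_split/=; congr (_ * _).
- rewrite prodr_const card_ord [d%:R / 2]mulrC powRN powRrM powR12_sqrt;
    last first.
    by rewrite !mulr_ge0 ?pi_ge0// ltW.
  by rewrite powR_mulrn ?sqrtr_ge0// exprVn.
- under eq_bigr do rewrite /gaussian subr0.
  rewrite -expR_sum sumrN -mulr_suml.
  by rewrite /enorm sqr_sqrtr// sumr_ge0// => i _; exact: sqr_ge0.
Qed.

(** Completing the square in [y]: up to constants, this is the semigroup property
    of the heat kernel between the times [t] and 1, before integration. *)
Lemma gaussian_mul k t s x y : 0 < t ->
  k * gaussian (4 * t) 0 (x - y) * gaussian 4 s y =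
  k * gaussian (4 * (t + 1)) s x *
  gaussian (4 * t / (t + 1)) ((x + t * s) / (t + 1)) y.
Proof.
move=> t0; rewrite -!mulrA; congr (_ * _).
rewrite /gaussian -!expRD; congr expR; field.
by rewrite !gt_eqF//; lra.
Qed.

(** Integrating [gaussian_mul] in each coordinate turns the parameter [4] (time 1)
    into [4 (t + 1)]; the surviving constant per coordinate is
    [(4 pi t)^(-1/2) (pi 4 t / (t + 1))^(1/2) = (t + 1)^(-1/2)]. *)
Lemma heat_semigroup_gaussian d t c s : 0 < t ->
  heat_semigroup t (fun x => c * gaussian_Rn d 4 s x) =
  (fun x => c * (Num.sqrt (t + 1))^-1 ^+ d * gaussian_Rn d (4 * (t + 1)) s x).
Proof.
move=> t0; rewrite /heat_semigroup gt_eqF//; apply/funext => x.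
have t1 : 0 < t + 1 by lra.
pose v := 4 * t / (t + 1); have v0 : 0 < v by rewrite !divr_gt0 ?mulr_gt0.
pose k := (Num.sqrt (4 * pi * t))^-1.
pose m (i : 'I_d) := (tnth x i + t * s) / (t + 1).
pose g (i : 'I_d) y :=
  k * gaussian (4 * (t + 1)) s (tnth x i) * gaussian v (m i) y.
have k0 : 0 <= k by rewrite invr_ge0 sqrtr_ge0.
have E y : heat_kernel t (subRn x y) * (c * gaussian_Rn d 4 s y) =
    c * \prod_(i < d) g i (tnth y i).
  rewrite heat_kernel_prod// mulrCA -big_split/=; congr (_ * _).
  apply: eq_bigr => i _; rewrite tnth_mktuple.
  exact: gaussian_mul.
have g0 i y : 0 <= g i y by rewrite !mulr_ge0 ?gaussian_ge0.
have mg i : measurable_fun [set: measurableTypeR R] (g i).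
  by apply: measurable_funM => //; exact: measurable_gaussian.
have ig i : (\int[lebesgue_measure]_y (g i y)%:E =
   ((Num.sqrt (t + 1))^-1 * gaussian (4 * (t + 1)) s (tnth x i))%:E)%E.
  under eq_integral do rewrite EFinM.
  rewrite ge0_integralZl_EFin//; last 3 first.
  - by move=> y _; rewrite lee_fin gaussian_ge0.
  - by apply/measurable_EFinP; exact: measurable_gaussian.
  - by rewrite mulr_ge0// gaussian_ge0.
  rewrite integral_gaussian// -EFinM; congr _%:E.
  rewrite mulrAC; congr (_ * _); rewrite /k.
  rewrite (_ : pi * v = 4 * pi * t / (t + 1)); last by rewrite /v; ring.
  have p0 : 0 < 4 * pi * t by rewrite !mulr_gt0// pi_gt0.
  rewrite [X in _ * X]sqrtrM ?(ltW p0)// sqrtrV ?(ltW t1)//.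
  rewrite mulrA mulVf ?mul1r//.
  by rewrite gt_eqF// sqrtr_gt0.
have iG : (\int[@lebesgue_Rn R d]_y (\prod_(i < d) g i (tnth y i))%:E =
    ((Num.sqrt (t + 1))^-1 ^+ d * gaussian_Rn d (4 * (t + 1)) s x)%:E)%E.
  rewrite integral_Rn_prod// (eq_bigr _ (fun i _ => ig i)) prodEFin.
  by rewrite big_split/= prodr_const card_ord.
rewrite (eq_Rintegral _ (fun y _ => E y)) RintegralZl//.
  by rewrite /Rintegral iG mulrA.
apply/integrableP; split.
  by apply/measurable_EFinP; exact: measurable_prod_tnth.
under eq_integral do rewrite /= ger0_norm ?prodr_ge0//.
by rewrite iG ltry.
Qed.

End gaussian_Rn.

(** * The cardinal functions and the sampling sum *)

Section sinc.
Context {R : realType}.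
Implicit Types x r : R.

Lemma norm_sin_le x : `|sin x| <= `|x|.
Proof.
wlog x0 : x / 0 < x => [h|].
  have [x0|x0|->] := ltgtP x 0; last by rewrite sin0.
    by rewrite -normrN -sinN -(normrN x); apply: h; rewrite oppr_gt0.
  exact: h.
have [c _] := @MVT R sin cos 0 x x0 (fun y _ => is_derive_sin y)
  (continuous_subspaceT (@continuous_sin R)).
by rewrite sin0 !subr0 => ->; rewrite normrM ler_piMl// cos_max.
Qed.

Lemma norm_sinc_pi_le1 r : `|sinc_pi r| <= 1.
Proof.
rewrite /sinc_pi; case: eqP => [_|/eqP r0]; first by rewrite normr1.
have pr0 : pi * r != 0 by rewrite mulf_neq0// gt_eqF// pi_gt0.
by rewrite normrM normfV ler_pdivrMr ?normr_gt0// mul1r norm_sin_le.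
Qed.

(** Writing [x^-1] as [x (x^2)^(-1)] reduces to a real power of a nonnegative
    base; at 0 both sides are 0. *)
Lemma measurable_inv : measurable_fun [set: R] (fun x : R => x^-1).
Proof.
rewrite (_ : (fun x => _) = fun x => x * (x ^+ 2) `^ (- 1)).
  apply: measurable_funM => //.
  exact: (measurableT_comp (measurable_powR (- 1)) (measurable_funX _ _)).
apply/funext => x; rewrite powR_inv1 ?sqr_ge0//.
by have [->|x0] := eqVneq x 0; [rewrite invr0 mul0r|field].
Qed.

Lemma measurable_sinc_pi : measurable_fun [set: R] (@sinc_pi R).
Proof.
have mpi : measurable_fun [set: R] (fun x : R => pi * x).
  exact: measurable_funM.
apply: measurable_fun_ifT => //; first exact: measurable_fun_eqr.
apply: measurable_funM; last exact: (measurableT_comp measurable_inv).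
apply: measurableT_comp => //; apply: continuous_measurable_fun.
exact: continuous_sin.
Qed.

End sinc.

Section sampling.
Context {R : realType}.
Implicit Types (d : nat) (N r e v s : R).

Lemma norm_cardinal_fun_le1 d N (n : d.-tuple int) (x : Rn R d) :
  `|cardinal_fun N n x| <= 1.
Proof.
rewrite /cardinal_fun normr_prod.
by apply: Num.Theory.prodr_ile1 => j _; rewrite normr_ge0 norm_sinc_pi_le1.
Qed.

Lemma measurable_cardinal_fun d N (n : d.-tuple int) :
  measurable_fun [set: Rn R d] (cardinal_fun N n).
Proof.
apply: (measurable_prod_tnth d
  (fun j y => sinc_pi (N * y - (tnth n j)%:~R))) => j.
apply: (measurableT_comp measurable_sinc_pi).
by apply: measurable_funB => //; exact: measurable_funM.
Qed.

Let index_set d r := [set n : d.-tuple int | enorm (lattice_pt (1 : R) n) <= r].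

Lemma norm_sampling_sum_le d N r e (w : Rn R d -> R) (x : Rn R d) :
  (forall n : d.-tuple int, enorm (lattice_pt (1 : R) n) <= r ->
     `|w (lattice_pt N n)| <= e) ->
  `|sampling_sum N r w x| <= e * #|` fset_set (index_set d r)|%:R.
Proof.
move=> we; rewrite /sampling_sum fsbig_finite; last exact: finite_sampling_set.
apply: le_trans (ler_norm_sum _ _ _) _.
rewrite mulr_natr -[X in _ *+ X]count_predT -iter_addr_0 -big_const_seq.
rewrite big_seq [leRHS]big_seq; apply: ler_sum => n.
rewrite in_fset_set; last exact: finite_sampling_set.
move=> /set_mem nr; rewrite normrM -[leRHS]mulr1.
by apply: ler_pM => //; [exact: (we n nr)|exact: norm_cardinal_fun_le1].
Qed.

Lemma measurable_sampling_sum d N r (w : Rn R d -> R) :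
  measurable_fun [set: Rn R d] (sampling_sum N r w).
Proof.
rewrite (_ : sampling_sum N r w = fun x => \sum_(n <- fset_set (index_set d r))
    w (lattice_pt N n) * cardinal_fun N n x); last first.
  apply/funext => x; rewrite /sampling_sum fsbig_finite//.
  exact: finite_sampling_set.
apply: measurable_sum => n; apply: measurable_funM => //.
exact: measurable_cardinal_fun.
Qed.

Lemma tnth_le_enorm d (x : Rn R d) i : tnth x i <= enorm x.
Proof.
apply: le_trans (ler_norm _) _; rewrite -sqrtr_sqr /enorm ler_wsqrtr//.
by rewrite (bigD1 i)//= lerDl sumr_ge0// => j _; exact: sqr_ge0.
Qed.

Lemma gaussian_Rn_le_tnth d v s (x : Rn R d) i : 0 <= v ->
  gaussian_Rn d v s x <= gaussian v s (tnth x i).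
Proof.
move=> v0; rewrite /gaussian_Rn (bigD1 i)//= ler_piMr ?gaussian_ge0//.
by apply: Num.Theory.prodr_ile1 => j _; rewrite gaussian_ge0 gaussian_le1.
Qed.

(** Every sampling point in the ball has its first coordinate at most [r / N]
    (this is where [d] must be positive), so a single far-away centre makes all
    samples small at once. *)
Lemma sampled_gaussian_vanishing d v N r e : (1 <= d)%N -> 0 < v -> 0 < N ->
  0 < e ->
  exists s, forall n : d.-tuple int, enorm (lattice_pt (1 : R) n) <= r ->
    gaussian_Rn d v s (lattice_pt N n) <= e.
Proof.
move=> d0 v0 N0 e0; have [s sP] := gaussian_vanishing v (r / N) e v0 e0.
exists s => n nr.
apply: le_trans (gaussian_Rn_le_tnth _ _ _ _ (Ordinal d0) (ltW v0)) _.
apply: sP; rewrite tnth_mktuple ler_pM2r ?invr_gt0//.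
apply: le_trans nr; apply: le_trans (tnth_le_enorm _ _ (Ordinal d0)).
by rewrite tnth_mktuple divr1.
Qed.

End sampling.

(** * Lower bounds for L^2 norms *)

(** Pointwise, [(f - g)^2 + 2 e f >= f^2 - 2 f g + 2 e f >= f^2] because [f] is
    nonnegative.  Unlike the triangle inequality, this needs a uniform bound on
    [g] but not its square integrability. *)
Lemma le_integral_sqr_perturb {d} {X : measurableType d} {R : realType}
    (mu : {measure set X -> \bar R}) (f g : X -> R) (e : R) :
  measurable_fun setT f -> measurable_fun setT g ->
  (forall x, 0 <= f x) -> (forall x, `|g x| <= e) -> 0 <= e ->
  (\int[mu]_x (f x ^+ 2)%:E <=
   \int[mu]_x ((f x - g x) ^+ 2)%:E + (2 * e)%:E * \int[mu]_x (f x)%:E)%E.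
Proof.
move=> mf mg f0 ge e0.
have mfg : measurable_fun setT (fun x => (f x - g x) ^+ 2).
  by apply: measurable_funX; exact: measurable_funB.
rewrite -ge0_integralZl_EFin//; last 3 first.
- by move=> x _; rewrite lee_fin.
- exact/measurable_EFinP.
- by rewrite mulr_ge0.
rewrite -ge0_integralD//; last 4 first.
- by move=> x _; rewrite lee_fin sqr_ge0.
- exact/measurable_EFinP.
- by move=> x _; rewrite -EFinM lee_fin !mulr_ge0.
- by apply: measurable_funeM; exact/measurable_EFinP.
apply: ge0_le_integral => //.
- by move=> x _; rewrite lee_fin sqr_ge0.
- by apply/measurable_EFinP; exact: measurable_funX.
- apply: emeasurable_funD; first exact/measurable_EFinP.
  by apply: measurable_funeM; exact/measurable_EFinP.
- move=> x _; rewrite -EFinM -EFinD lee_fin.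
  have := ge x; rewrite ler_norml => /andP[_ gxe].
  have := sqr_ge0 (g x); have : f x * g x <= f x * e by rewrite ler_wpM2l.
  nra.
Qed.

Section L2norm.
Context {R : realType}.

Lemma L2normE d (f : Rn R d -> R) :
  (L2norm f = (\int[@lebesgue_Rn R d]_x (f x ^+ 2)%:E) `^ 2^-1)%E.
Proof.
rewrite /L2norm unlock /=; congr poweR; apply: eq_integral => x _.
by rewrite powR_mulrn// real_normK// num_real.
Qed.

Lemma le_L2norm d (f : Rn R d -> R) (r : R) : 0 <= r ->
  ((r ^+ 2)%:E <= \int[@lebesgue_Rn R d]_x (f x ^+ 2)%:E)%E ->
  (r%:E <= L2norm f)%E.
Proof.
move=> r0 rf; rewrite L2normE.
rewrite (_ : r%:E = ((r ^+ 2)%:E `^ 2^-1)%E); last first.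
  by rewrite poweR_EFin powR12_sqrt ?sqr_ge0// sqrtr_sqr ger0_norm.
apply: gt0_ler_poweR => //; rewrite ?in_itv/= ?andbT ?leey ?lee_fin ?sqr_ge0//.
by rewrite integral_ge0// => x _; rewrite lee_fin sqr_ge0.
Qed.

Lemma integral_sqr_gaussian_Rn d (a v s : R) : 0 < v ->
  (\int[@lebesgue_Rn R d]_x ((a * gaussian_Rn d v s x) ^+ 2)%:E =
   (a ^+ 2 * Num.sqrt (pi * (v / 2)) ^+ d)%:E)%E.
Proof.
move=> v0; under eq_integral do rewrite exprMn gaussian_RnX2 EFinM.
rewrite ge0_integralZl_EFin ?sqr_ge0//; last 2 first.
- by move=> x _; rewrite lee_fin gaussian_Rn_ge0.
- by apply/measurable_EFinP; exact: measurable_gaussian_Rn.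
by rewrite integral_gaussian_Rn ?divr_gt0.
Qed.

Lemma Lfun2_gaussian_Rn d (a v s : R) : 0 < v ->
  (fun x => a * gaussian_Rn d v s x) \in Lfun (@lebesgue_Rn R d) 2%:E.
Proof.
move=> v0; apply/andP; split; rewrite inE/=.
  by apply: measurable_funM => //; exact: measurable_gaussian_Rn.
suff : (L2norm (fun x : Rn R d => (a * gaussian_Rn d v s x)%R) < +oo)%E by [].
by rewrite L2normE integral_sqr_gaussian_Rn// poweR_EFin ltry.
Qed.

End L2norm.

(** * A unit Gaussian and its evolution *)

Section unit_gaussian.
Context {R : realType}.
Implicit Types (d : nat) (s t : R) (N r e : R).

(** The constant [(2 pi)^(-d/4)] makes the L^2 norm equal to 1. *)
Definition unit_gaussian d s (x : Rn R d) : R :=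
  (Num.sqrt (Num.sqrt (pi * 2)))^-1 ^+ d * gaussian_Rn d 4 s x.

(** The image of [unit_gaussian] under the heat semigroup at time [t]. *)
Definition evolved_gaussian d t s (x : Rn R d) : R :=
  (Num.sqrt (Num.sqrt (pi * 2)))^-1 ^+ d * (Num.sqrt (t + 1))^-1 ^+ d *
  gaussian_Rn d (4 * (t + 1)) s x.

Let sqrt2pi_gt0 : 0 < Num.sqrt (pi * 2) :> R.
Proof. by rewrite sqrtr_gt0 mulr_gt0// pi_gt0. Qed.

Let norming d : (Num.sqrt (Num.sqrt (pi * 2)))^-1 ^+ d ^+ 2 *
  Num.sqrt (pi * 2) ^+ d = 1 :> R.
Proof.
rewrite -exprM mulnC exprM exprVn sqr_sqrtr; last exact: ltW.
by rewrite -exprMn mulVf ?gt_eqF// expr1n.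
Qed.

Lemma integral_sqr_unit_gaussian d s :
  (\int[@lebesgue_Rn R d]_x (unit_gaussian d s x ^+ 2)%:E = 1)%E.
Proof.
rewrite integral_sqr_gaussian_Rn// (_ : 4 / 2 = 2 :> R); last by field.
by rewrite norming.
Qed.

Lemma integral_sqr_evolved_gaussian d t s : 0 < t + 1 ->
  (\int[@lebesgue_Rn R d]_x (evolved_gaussian d t s x ^+ 2)%:E =
   ((Num.sqrt (t + 1))^-1 ^+ d)%:E)%E.
Proof.
move=> t1; have q0 : 0 < Num.sqrt (t + 1) by rewrite sqrtr_gt0.
rewrite integral_sqr_gaussian_Rn ?mulr_gt0//; congr _%:E.
rewrite (_ : pi * (4 * (t + 1) / 2) = (pi * 2) * (t + 1)); last by field.
rewrite [Num.sqrt (pi * 2 * _)]sqrtrM; last by rewrite mulr_ge0// pi_ge0.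
rewrite !exprMn mulrACA norming mul1r.
by rewrite -exprM mulnC exprM -exprMn expr2 -mulrA mulVf ?gt_eqF// mulr1.
Qed.

Lemma integral_evolved_gaussian d t : 0 < t + 1 ->
  exists2 M : R, 0 <= M & forall s,
    (\int[@lebesgue_Rn R d]_x (evolved_gaussian d t s x)%:E = M%:E)%E.
Proof.
move=> t1; have v0 : 0 < 4 * (t + 1) by rewrite mulr_gt0.
pose A : R :=
  (Num.sqrt (Num.sqrt (pi * 2)))^-1 ^+ d * (Num.sqrt (t + 1))^-1 ^+ d.
have A0 : 0 <= A by rewrite mulr_ge0// exprn_ge0// invr_ge0 sqrtr_ge0.
exists (A * Num.sqrt (pi * (4 * (t + 1))) ^+ d) => [|s].
  by rewrite mulr_ge0// exprn_ge0// sqrtr_ge0.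
under eq_integral do rewrite EFinM.
rewrite ge0_integralZl_EFin//; last 2 first.
- by move=> x _; rewrite lee_fin gaussian_Rn_ge0.
- by apply/measurable_EFinP; exact: measurable_gaussian_Rn.
by rewrite integral_gaussian_Rn.
Qed.

Lemma evolved_gaussian_ge0 d t s x : 0 <= evolved_gaussian d t s x.
Proof.
apply: mulr_ge0; last exact: gaussian_Rn_ge0.
by rewrite mulr_ge0// exprn_ge0// invr_ge0 sqrtr_ge0.
Qed.

Lemma measurable_evolved_gaussian d t s :
  measurable_fun [set: Rn R d] (evolved_gaussian d t s).
Proof. by apply: measurable_funM => //; exact: measurable_gaussian_Rn. Qed.

Lemma sampling_sum_evolved_gaussian_vanishing d t N r e :
  (1 <= d)%N -> 0 < t + 1 -> 0 < N -> 0 < e ->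
  exists s, forall x, `|sampling_sum N r (evolved_gaussian d t s) x| <= e.
Proof.
move=> d0 t1 N0 e0; have v0 : 0 < 4 * (t + 1) by rewrite mulr_gt0.
pose A : R :=
  (Num.sqrt (Num.sqrt (pi * 2)))^-1 ^+ d * (Num.sqrt (t + 1))^-1 ^+ d.
have A0 : 0 < A by rewrite mulr_gt0// exprn_gt0// invr_gt0 sqrtr_gt0.
pose K : R :=
  #|` fset_set [set n : d.-tuple int | enorm (lattice_pt (1 : R) n) <= r]|%:R.
have K0 : 0 <= K by exact: ler0n.
(* [K + 1] instead of [K], which vanishes when the index set is empty. *)
pose e' := e / (A * (K + 1)).
have e'0 : 0 < e' by rewrite divr_gt0// mulr_gt0//; lra.
have [s sP] := sampled_gaussian_vanishing d _ _ r e' d0 v0 N0 e'0.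
exists s => x; apply: (@le_trans _ _ (A * e' * K)).
  apply: norm_sampling_sum_le => n nr.
  by rewrite ger0_norm ?evolved_gaussian_ge0// ler_pM2l// sP.
rewrite (_ : A * e' * K = e * (K / (K + 1))); last first.
  by rewrite /e'; field; rewrite !gt_eqF//; lra.
by rewrite ger_pMr// ler_pdivrMr; lra.
Qed.

End unit_gaussian.

(** * The lower bound for the sampling error *)

Theorem proposition3p1 (R : realType) (d : nat) (hd : (1 <= d)%N)
    (T N : R) (hT : 0 < T) (hN : 0 < N)
    (G : R -> R) (hGpos : forall r : R, 0 < r -> 0 < G r)
    (hGcont : {within [set r : R | 0 < r], continuous G}) :
  ((2^-1 * (T + 1) `^ (- (d%:R / 4)))%:E <=
   ereal_sup [set sampling_error T N (G N) u
             | u in [set u : R -> Rn R d -> R |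
                      heat_solution u /\ (L2norm (u 0%R) <= 1)%E]])%E.
Proof.
have p0 : 0 < T + 1 by lra.
pose r := 2^-1 * (T + 1) `^ (- (d%:R / 4)).
have r0 : 0 < r by rewrite mulr_gt0 ?invr_gt0// powR_gt0.
have r2 : r ^+ 2 = 4^-1 * (Num.sqrt (T + 1))^-1 ^+ d.
  rewrite exprMn -[X in _ * X]powR_mulrn ?powR_ge0// -powRrM.
  rewrite (_ : - (d%:R / 4) * 2 = - (2^-1 * d%:R)); last by field.
  rewrite powRN powRrM powR12_sqrt ?(ltW p0)// powR_mulrn ?sqrtr_ge0//.
  by rewrite exprVn; congr (_ * _); field.
have [M M0 iM] := integral_evolved_gaussian d T p0.
(* The evolved Gaussian has squared norm [4 r^2], so that an error [2 e M] in
   [le_integral_sqr_perturb] is affordable as soon as [e M <= r^2]. *)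
pose e := r ^+ 2 / (M + 1).
have e0 : 0 < e by rewrite divr_gt0 ?exprn_gt0//; lra.
have eM : e * M <= r ^+ 2.
  by rewrite /e mulrAC ler_pdivrMr ?ler_pM2l ?exprn_gt0//; lra.
have [s Se] :=
  sampling_sum_evolved_gaussian_vanishing d _ _ (G N) _ hd p0 hN e0.
pose u t := heat_semigroup t (unit_gaussian d s).
have uT : u T = evolved_gaussian d T s by exact: heat_semigroup_gaussian.
have u0 : u 0 = unit_gaussian d s by rewrite /u /heat_semigroup eqxx.
apply: (@le_trans _ _ (sampling_error T N (G N) u)); last first.
  apply: ereal_sup_ubound; exists u => //; split; last first.
    by rewrite u0 L2normE integral_sqr_unit_gaussian poweR_EFin powR1.
  by split=> [|t t0]; rewrite u0//; exact: Lfun2_gaussian_Rn.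
apply: le_L2norm; first exact: ltW.
have := le_integral_sqr_perturb (lebesgue_Rn d) _ _ _
  (measurable_evolved_gaussian d T s) (measurable_sampling_sum d N (G N) _)
  (evolved_gaussian_ge0 d T s) Se (ltW e0).
rewrite uT iM integral_sqr_evolved_gaussian//.
case: (\int[_]_x _)%E => [b||]; last 2 first.
- by move=> _; exact: leey.
- by rewrite addNye leeNy_eq => /eqP.
by rewrite -EFinM -EFinD !lee_fin -/r => h; have := sqr_ge0 r; lra.
Qed.
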